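(* Let $1\le n<\omega$ and let $\mathcal A=(A;E_0,\dots,E_{n-1})$ be an $n$-indexed hyperspace such that for no $n$-tuple $\vec S=\langle S_0,\dots,S_{n-1}\rangle$ of nonempty subsets of $n$ is the $\vec S$-halfcube weakly embeddable into $\mathcal A$. Then $\mathcal A$ has an acceptable coloring.
   Context: An $n$-indexed hyperspace is a structure $\mathcal A=(A;E_0,\dots,E_{n-1})$ with each $E_i$ an equivalence relation on $A$; $[a]_i$ is the $E_i$-class of $a$. A coloring is a function $\chi:A\to n=\{0,\dots,n-1\}$; it is acceptable if for every $a\in A$ and $i<n$ the set $\{x\in[a]_i:\chi(x)=i\}$ is finite. For $m<\omega$, $\langle\omega\rangle^m$ is the set of strictly increasing $m$-tuples of natural numbers. If $\vec S=\langle S_0,\dots,S_{n-1}\rangle$ is an $n$-tuple of subsets of $m$, the $\vec S$-cube over $\omega$ is $(\omega^m;E_0,\dots,E_{n-1})$ where $\langle x,y\rangle\in E_i$ iff $x_j=y_j$ for every $j\in m\setminus S_i$; the $\vec S$-halfcube is its substructure with universe $\langle\omega\rangle^m$. If $\mathcal A,\mathcal B$ are $n$-indexed hyperspaces, a weak embedding of $\mathcal B$ into $\mathcal A$ is a one-to-one $f:B\to A$ for which there is a permutation $\pi$ of $n$ such that for all $x,y\in B$ and $i<n$: $[x]_{\pi(i)}=[y]_{\pi(i)}\iff[f(x)]_i=[f(y)]_i$. *)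

(* Defs.v *)
From mathcomp Require Import all_boot all_fingroup.
From mathcomp Require Import boolp classical_sets cardinality.
From Corelib Require Export RelationClasses.

Set Implicit Arguments.
Unset Strict Implicit.
Unset Printing Implicit Defensive.

Local Open Scope classical_set_scope.

Record hyperspace (n : nat) := Hyperspace {
  carrier :> Type;
  hrel : 'I_n -> carrier -> carrier -> Prop;
  hrel_equiv : forall i, Equivalence (hrel i)
}.

Definition eqclass (n : nat) (A : hyperspace n) (i : 'I_n) (a : A) : set A :=
  [set x | hrel i a x].

Definition acceptable (n : nat) (A : hyperspace n) (chi : A -> 'I_n) : Prop :=
  forall (a : A) (i : 'I_n), finite_set (eqclass i a `&` [set x | chi x = i]).

Lemma sub_hrel_equiv (n : nat) (A : hyperspace n) (P : pred A) (i : 'I_n) :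
  Equivalence (fun x y : {x : A | P x} => hrel i (sval x) (sval y)).
Proof.
have [r s t] := hrel_equiv A i.
by split=> [x|x y|x y z]; [exact: r | exact: s | exact: t].
Qed.

Definition subhyperspace (n : nat) (A : hyperspace n) (P : pred A) :
  hyperspace n := Hyperspace (sub_hrel_equiv P).

Definition cube_rel (n m : nat) (S : 'I_n -> {set 'I_m}) (i : 'I_n)
  (x y : m.-tuple nat) : Prop :=
  forall j : 'I_m, j \notin S i -> tnth x j = tnth y j.

Lemma cube_rel_equiv (n m : nat) (S : 'I_n -> {set 'I_m}) (i : 'I_n) :
  Equivalence (cube_rel S i).
Proof.
split=> [x j //|x y xy j jS|x y z xy yz j jS]; first by rewrite xy.
by rewrite xy // yz.
Qed.

Definition cube (n m : nat) (S : 'I_n -> {set 'I_m}) : hyperspace n :=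
  Hyperspace (cube_rel_equiv S).

Definition halfcube (n m : nat) (S : 'I_n -> {set 'I_m}) : hyperspace n :=
  @subhyperspace n (cube S) (fun x : m.-tuple nat => sorted ltn x).

Definition weak_embedding (n : nat) (B A : hyperspace n) (f : B -> A) : Prop :=
  injective f /\
  exists p : {perm 'I_n}, forall (x y : B) (i : 'I_n),
    eqclass (p i) x = eqclass (p i) y <-> eqclass i (f x) = eqclass i (f y).

Definition weakly_embeddable (n : nat) (B A : hyperspace n) : Prop :=
  exists f : B -> A, weak_embedding f.

(* Main.v *)
(**
Stronger claim, by induction on the size of a set [I] of colours: if a subset
[P] of the space has no acceptable colouring using only the colours in [I],
then [P] contains a halfcube of dimension at most [#|I|] on which every [E i],
also for [i] outside [I], is the cube relation of some [S i], with [S i]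
nonempty for [i] in [I].

Work with subsets closed under Skolem functions for quantifier-free types in
the language of equality, [P] and the [E i]. Write [P] as the union of an
increasing well-ordered chain of such sets, each already colourable. If [M] is
the union of the earlier sets and [x] is new, let [J] be the set of [i] such
that the [E i]-class of [x] meets [M]. Colouring the new points with given [J]
by [I :\: J] gives an acceptable colouring, since a class receives its own
colour only at the first stage that it meets. If these points cannot be coloured
in this way, the induction hypothesis provides a halfcube among them. Each of
its finite parts has copies in [M] with the same [E j]-classes for [j] in [J],
and with [E i]-classes avoiding any prescribed finite part of [M] for [i] not in
[J]. Indexing these copies by a new last coordinate yields a halfcube in which
that coordinate belongs to [S j] exactly for [j] in [J].
*)
Require Import Defs.
From mathcomp Require Import all_fingroup.
From mathcomp Require Import boolp classical_sets functions cardinality wochoice.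
From mathcomp Require Import all_boot.

Set Implicit Arguments.
Unset Strict Implicit.
Unset Printing Implicit Defensive.

Local Open Scope classical_set_scope.

(** * Skolem functions for quantifier-free types *)

Section SkolemClosure.
Variables (A : choiceType) (K : finType) (r : K -> A -> A -> Prop).

(** A truth table rather than a set of formulas: its values can be coded by natural numbers, and its
    shape records the length of [s]. *)
Definition qf_type (s : seq A) : seq (seq (seq bool)) :=
  [seq [seq [seq `[< r k x y >] | k <- enum K] | y <- s] | x <- s].

Lemma qf_typeP (s s' : seq A) : qf_type s = qf_type s' ->
  forall x0 k i j, i < size s -> j < size s ->
  (r k (nth x0 s i) (nth x0 s j) <-> r k (nth x0 s' i) (nth x0 s' j)).
Proof.
move=> ss' x0 k i j i_s j_s.
have sz : size s = size s' by have := congr1 size ss'; rewrite !size_map.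
have := congr1 (fun u => nth false (nth [::] (nth [::] u i) j) (index k (enum K))) ss'.
rewrite /= !(nth_map x0) -?sz // !(nth_map k) -?enumT ?index_mem ?mem_enum //.
rewrite nth_index ?mem_enum // => H.
by split=> /asboolP; [rewrite H|rewrite -H] => /asboolP.
Qed.

(* [t] encodes a type [tau] together with an index into a realization [f] of
   [tau] over [x0 :: d]; the value is [x0] when there is no realization. *)
Definition skolem (x0 : A) (d : seq A) (t : nat) : A :=
  if unpickle t is Some (tau, k) then
    if pselect (exists f, qf_type (x0 :: d ++ f) = tau) is left e
    then nth x0 (projT1 (cid e)) k else x0
  else x0.

Definition skolem_closed (M : set A) := forall x0 d t,
  M x0 -> (forall a, a \in d -> M a) -> M (skolem x0 d t).

(** The type of [map f e] over [x0 :: d] is realized, so the Skolem functions produce a realization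
    with entries in [M]. *)
Lemma skolem_closed_copy (M : set A) (X : eqType) (e : seq X) (f : X -> A)
    (x0 : A) (d : seq A) :
  skolem_closed M -> M x0 -> (forall a, a \in d -> M a) ->
  exists f' : X -> A,
    [/\ forall x, x \in e -> M (f' x),
        forall k x y, x \in e -> y \in e -> (r k (f x) (f y) <-> r k (f' x) (f' y))
      & forall k x a, x \in e -> a \in d -> (r k (f x) a <-> r k (f' x) a)].
Proof.
move=> Mcl Mx0 Md; pose tau := qf_type (x0 :: d ++ map f e).
pose t x := pickle (tau, index x e).
have [g gtau fg] : exists2 g, qf_type (x0 :: d ++ g) = tau &
    forall x, skolem x0 d (t x) = nth x0 g (index x e).
  have ex : exists g, qf_type (x0 :: d ++ g) = tau by exists (map f e).
  exists (projT1 (cid ex)) => [|x]; first exact: (projT2 (cid ex)).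
  (* [cid] chooses from a proof of existence; identifying the proofs makes all entries come from one
     realization. *)
  rewrite /skolem /t pickleK; case: pselect => // ex'.
  by rewrite (Prop_irrelevance ex' ex).
exists (fun x => nth x0 g (index x e)).
have nthe x s :
    nth x0 s (index x e) = nth x0 (x0 :: d ++ s) (size d + index x e).+1.
  by rewrite /= nth_cat ltnNge leq_addr /= addKn.
have szg : size g = size e.
  have := congr1 size gtau; rewrite !size_map /= !size_cat size_map.
  by move=> -[/addnI].
have fE x : x \in e -> f x = nth x0 (x0 :: d ++ map f e) (size d + index x e).+1.
  by move=> xe; rewrite -nthe (nth_map x) ?index_mem // nth_index.
have idx x : x \in e -> (size d + index x e).+1 < size (x0 :: d ++ map f e).
  by move=> xe; rewrite /= ltnS size_cat size_map ltn_add2l index_mem.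
have T := qf_typeP (esym gtau).
split=> [x xe|k x y xe ye|k x a xe ad].
- by rewrite -fg; apply: Mcl.
- rewrite !nthe // !fE //; apply: T; exact: idx.
- rewrite nthe // fE //.
  have aE s : a = nth x0 (x0 :: d ++ s) (index a d).+1.
    by rewrite /= nth_cat index_mem ad nth_index.
  rewrite [X in r k _ X <-> _](aE (map f e)) [X in _ <-> r k _ X](aE g).
  apply: T; first exact: idx.
  by rewrite /= ltnS size_cat ltn_addr // index_mem.
Qed.

(* The extra argument [x0] of [skolem] makes the hull of the empty set empty, so
   that hulls commute with unions of arbitrary, possibly empty, chains. *)
Inductive skolem_hull (X : set A) : set A :=
| skolem_hull_gen x : X x -> skolem_hull X x
| skolem_hull_fun x0 d t : skolem_hull X x0 ->
    (forall a, a \in d -> skolem_hull X a) -> skolem_hull X (skolem x0 d t).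

Lemma skolem_hull_closed (X : set A) : skolem_closed (skolem_hull X).
Proof. by move=> x0 d t; exact: skolem_hull_fun. Qed.

Lemma skolem_hull_min (X M : set A) :
  X `<=` M -> skolem_closed M -> skolem_hull X `<=` M.
Proof. by move=> XM Mcl x; elim=> [y /XM //|x0 d t _ Mx0 _ Md]; apply: Mcl. Qed.

Lemma skolem_hull_mono (X Y : set A) : X `<=` Y -> skolem_hull X `<=` skolem_hull Y.
Proof.
move=> XY; apply: skolem_hull_min; last exact: skolem_hull_closed.
by move=> x /XY; exact: skolem_hull_gen.
Qed.

Lemma skolem_closed_bigcup (I : Type) (W : set I) (M : I -> set A) :
  (forall i j, W i -> W j -> M i `<=` M j \/ M j `<=` M i) ->
  (forall i, W i -> skolem_closed (M i)) -> skolem_closed (\bigcup_(i in W) M i).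
Proof.
move=> chainM Mcl x0 d t [i Wi Mix0] Md.
suff [j Wj [Mjx0 Mjd]] : exists2 j, W j & M j x0 /\ forall a, a \in d -> M j a.
  by exists j => //; apply: Mcl.
elim: d Md => [|b d IH] Md; first by exists i.
have [a ad|j Wj [Mjx0 Mjd]] := IH; first by apply: Md; rewrite inE ad orbT.
have [k Wk Mkb] := Md b (mem_head _ _).
have [jk|kj] := chainM j k Wj Wk.
  exists k => //; split; first exact: jk.
  by move=> a; rewrite inE => /orP[/eqP ->//|/Mjd]; exact: jk.
exists j => //; split=> // a; rewrite inE => /orP[/eqP ->|/Mjd //]; exact: kj.
Qed.

(** Every element of the hull is the value of a finite tree: leaves name generators, nodes carry
    Skolem codes, and the first child plays the role of [x0]. *)
Lemma countable_skolem_hull (X : set A) : countable X -> countable (skolem_hull X).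
Proof.
move=> /countable_injP[c cinj].
have [->|/set0P[x0 _]] := eqVneq (skolem_hull X) classical_sets.set0; first exact: countable0.
have [g gP] : exists g : nat -> A, X `<=` range g.
  have /choice[g gP] : forall k, exists y, forall x, X x -> c x = k -> y = x.
    move=> k; have [[y Xy yk]|nk] := pselect (exists2 y, X y & c y = k).
      by exists y => x Xx xk; apply: cinj; rewrite ?yk //; exact: mem_set.
    by exists x0 => x Xx xk; case: nk; exists x.
  by exists g => x Xx; exists (c x) => //; exact: gP.
pose fix eval (t : GenTree.tree nat) : A :=
  match t with
  | GenTree.Leaf k => g k
  | GenTree.Node t s => if map eval s is a :: d then skolem a d t else x0
  end.
have hull_eval : skolem_hull X `<=` range eval.
  apply: skolem_hull_min => [x /gP[k _ <-]|_ d t [u _ <-] ed].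
    by exists (GenTree.Leaf k).
  have [s sd] : exists s, map eval s = d.
    elim: d ed => [|a d IH] ed; first by exists [::].
    have [b bd|s sd] := IH; first by apply: ed; rewrite inE bd orbT.
    have [v _ va] := ed a (mem_head _ _).
    by exists (v :: s); rewrite /= va sd.
  by exists (GenTree.Node t (u :: s)) => //=; rewrite sd.
apply: (card_le_trans (subset_card_le hull_eval)).
exact: (card_le_trans (card_image_le _ _) (countableP _)).
Qed.

End SkolemClosure.

(** * Increasing sequences and a pairing code *)

Definition increasing (m : nat) (x : seq nat) := (size x == m) && sorted ltn x.

Lemma increasing_rcons m x t :
  increasing m.+1 (rcons x t) = increasing m x && all (gtn t) x.
Proof.
rewrite /increasing size_rcons eqSS -andbA; congr (_ && _).
case: x => //= a x; rewrite rcons_path; elim: x a => [|b x IH] a /=.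
  by rewrite andbT.
rewrite -andbA IH; case ab: (a < b) => //=.
apply: andb_id2l => _; apply/idP/idP => [/andP[bt ->]|/andP[_ /andP[-> ->]] //].
by rewrite bt (ltn_trans ab bt).
Qed.

Lemma increasingS m z : increasing m.+1 z ->
  exists x t, [/\ z = rcons x t, increasing m x & all (gtn t) x].
Proof.
case/lastP: z => [//|x t]; rewrite increasing_rcons => /andP[xm xt].
by exists x, t.
Qed.

Definition bounded_seqs (m t : nat) : seq (seq nat) :=
  iter m (fun l => [seq a :: s | a <- iota 0 t, s <- l]) [:: [::]].

Lemma mem_bounded_seqs m t x :
  (x \in bounded_seqs m t) = (size x == m) && all (gtn t) x.
Proof.
elim: m x => [|m IH] x /=; first by rewrite inE; case: x.
apply/allpairsP/idP => [[[a s] /= [+ + ->]]|].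
  by rewrite mem_iota IH /= eqSS add0n => -> /andP[-> ->].
case: x => [//|a s] /=; rewrite eqSS => /andP[sm /andP[at_ st]].
by exists (a, s); rewrite /= mem_iota IH sm.
Qed.

Lemma infinite_set_seq (T : Type) (Q : set T) :
  infinite_set Q -> exists2 u : nat -> T, injective u & forall k, Q (u k).
Proof.
elim/Ppointed: T Q => T Q; first by rewrite emptyE; case.
move=> /infiniteP/pcard_leP[u]; exists u; last by move=> k; exact: funS.
by move=> j k; apply: inj; exact: mem_set.
Qed.

(** For [a < b] the code lies below the next square, so [b] is its integer square root and [a] the
    remainder. *)
Lemma square_code_inj (a b a' b' : nat) : a < b -> a' < b' ->
  b * b + a = b' * b' + a' -> a = a' /\ b = b'.
Proof.
have lt c d c' d' : c < d -> d < d' -> d * d + c < d' * d' + c'.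
  move=> cd dd'; apply: (@leq_trans (d * d.+1)).
    by rewrite mulnS [d + _]addnC ltn_add2l.
  by apply: leq_trans (leq_addr _ _); apply: leq_mul => //; exact: ltnW.
move=> ab ab'; case: (ltngtP b b') => [bb'|bb'|<-] H.
- by have := lt a b a' b' ab bb'; rewrite H ltnn.
- by have := lt a' b' a b ab' bb'; rewrite H ltnn.
- by split=> //; exact: addnI H.
Qed.

(** * Halfcubes in a set: extension and padding *)

Section Halfcubes.
Variables (n : nat) (A : choiceType) (E : 'I_n -> A -> A -> Prop).
Hypothesis E_equiv : forall i, Equivalence (E i).

Let E_refl i x : E i x x. Proof. by have [] := E_equiv i. Qed.
Let E_sym i x y : E i x y -> E i y x.
Proof. by have [_ s _] := E_equiv i; exact: s. Qed.
Let E_trans i y x z : E i x y -> E i y z -> E i x z.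
Proof. by have [_ _ t] := E_equiv i; exact: t. Qed.

(** Tuples are plain lists and coordinates plain numbers, so that the dimension can change without
    casts. *)
Definition halfcube_in (P : set A) (m : nat) (S : 'I_n -> pred nat)
    (h : seq nat -> A) : Prop :=
  [/\ forall x, increasing m x -> P (h x),
      forall x y, increasing m x -> increasing m y -> h x = h y -> x = y
    & forall i x y, increasing m x -> increasing m y ->
      (E i (h x) (h y) <->
       forall k, k < m -> ~~ S i k -> nth 0 x k = nth 0 y k)].

Definition structure_rel (P : set A) (k : option (option 'I_n)) (x y : A) : Prop :=
  match k with
  | None => x = y
  | Some None => P x
  | Some (Some i) => E i x y
  end.

(** Stage [t] copies into [M] the finitely many [h x] with entries of [x] below [t], over all
    earlier copies and over witnesses in [M] for the classes with index in [J]. The tuple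
    [rcons x t] goes to the copy of [h x] made at stage [t]. *)
Lemma halfcube_extend (P Q M : set A) (J : {set 'I_n}) m S h :
  skolem_closed (structure_rel P) M -> M !=set0 -> Q `<=` P ->
  (forall x, Q x -> ~ M x) ->
  (forall x i, Q x -> (i \in J <-> exists2 y, M y & E i x y)) ->
  halfcube_in Q m S h ->
  exists h', halfcube_in P m.+1 (fun i k => if k < m then S i k else i \in J) h'.
Proof.
move=> Mcl [x0 Mx0] QP QM QJ [hQ hinj hE].
have /choice[w wP] : forall p : A * 'I_n, exists y, M y /\
    (Q p.1 -> p.2 \in J -> E p.2 p.1 y).
  move=> [x i] /=; have [[Qx iJ]|nQ] := pselect (Q x /\ i \in J).
    by have [y My xy] := (QJ x i Qx).1 iJ; exists y.
  by exists x0; split=> // Qx iJ; case: nQ.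
pose e t := [seq x <- bounded_seqs m t | increasing m x].
have eP t x : (x \in e t) = increasing m x && all (gtn t) x.
  rewrite mem_filter mem_bounded_seqs /increasing; by case: (size x == m) => //=.
have eQ t x : x \in e t -> Q (h x) by rewrite eP => /andP[/hQ].
pose W t := [seq w (h x, i) | x <- e t, i <- enum 'I_n].
have /choice[F FP] : forall td : nat * seq A, exists f : seq nat -> A,
    (forall a, a \in td.2 -> M a) ->
    [/\ forall x, x \in e td.1 -> M (f x),
        forall k x y, x \in e td.1 -> y \in e td.1 ->
          (structure_rel P k (h x) (h y) <-> structure_rel P k (f x) (f y))
      & forall k x a, x \in e td.1 -> a \in W td.1 ++ td.2 ->
          (structure_rel P k (h x) a <-> structure_rel P k (f x) a)].
  move=> [t d] /=; have [dM|ndM] := pselect (forall a, a \in d -> M a); last first.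
    by exists h => /ndM.
  have [|f fP] := @skolem_closed_copy _ _ _ _ _ (e t) h x0 (W t ++ d) Mcl Mx0.
    move=> a; rewrite mem_cat => /orP[/allpairsP[[x i] [_ _ ->]]|/dM //].
    by have [] := wP (h x, i).
  by exists f.
(* [D t] lists the copies made before stage [t]. *)
pose fix D t := if t is s.+1 then D s ++ [seq F (s, D s) x | x <- e s] else [::].
have DM t a : a \in D t -> M a.
  elim: t a => [//|t IH] a /=; rewrite mem_cat => /orP[/IH //|/mapP[x xe ->]].
  by have [+ _ _] := FP (t, D t) IH; exact.
pose G t := F (t, D t).
have GM t x : x \in e t -> M (G t x).
  by have [+ _ _] := FP (t, D t) (DM t); exact.
have GG t k x y : x \in e t -> y \in e t ->
    (structure_rel P k (h x) (h y) <-> structure_rel P k (G t x) (G t y)).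
  by have [_ + _] := FP (t, D t) (DM t); exact.
have GD t k x a : x \in e t -> a \in W t ++ D t ->
    (structure_rel P k (h x) a <-> structure_rel P k (G t x) a).
  by have [_ _ +] := FP (t, D t) (DM t); exact.
have Dmono s t a : s <= t -> a \in D s -> a \in D t.
  move/subnKC <-; elim: (t - s) => [|u IH] aD; first by rewrite addn0.
  by rewrite addnS /= mem_cat IH.
have DG s t x : s < t -> x \in e s -> G s x \in D t.
  move=> st xe; apply: (Dmono _ _ _ st) => /=.
  by rewrite mem_cat (map_f (F (s, D s))) // orbT.
have GP t x : x \in e t -> P (G t x).
  by move=> xe; apply: (GG t (Some None) x x xe xe).1 => /=; exact/QP/(eQ t).
have GJ t x i : x \in e t -> i \in J -> E i (G t x) (w (h x, i)).
  move=> xe iJ; apply: (GD t (Some (Some i)) x _ xe _).1.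
    by rewrite mem_cat (allpairs_f (fun x i => w (h x, i))) ?mem_enum.
  by have [_] := wP (h x, i); apply=> //; exact: (eQ t).
(* For [i] in [J] a copy is [E i]-related to the witness, hence to the original point, whatever the
   stage. *)
have GJE s t x y i : x \in e s -> y \in e t -> i \in J ->
    (E i (G s x) (G t y) <-> E i (h x) (h y)).
  move=> xe ye iJ; have xw := GJ s x i xe iJ; have yw := GJ t y i ye iJ.
  have [_ /= hxw] := wP (h x, i); have {}hxw := hxw (eQ _ _ xe) iJ.
  have [_ /= hyw] := wP (h y, i); have {}hyw := hyw (eQ _ _ ye) iJ.
  split=> H.
    apply: (E_trans hxw); apply: (E_trans (E_sym xw)).
    by apply: (E_trans H); apply: (E_trans yw); exact: E_sym.
  apply: (E_trans xw); apply: (E_trans (E_sym hxw)).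
  by apply: (E_trans H); apply: (E_trans hyw); exact: E_sym.
(* The class of [h y] misses [M], where the earlier copy lies; that copy is a parameter of stage
   [t], so the new copy is unrelated to it as well. *)
have GN s t x y i : s < t -> x \in e s -> y \in e t -> i \notin J ->
    ~ E i (G t y) (G s x).
  move=> st xe ye iJ /(GD t (Some (Some i)) y _ ye _).2 H; move/negP: iJ; apply.
  apply/(QJ (h y) i (eQ _ _ ye)); exists (G s x); first exact: GM.
  by apply: H; rewrite mem_cat DG ?orbT.
have Gneq s t x y : s < t -> x \in e s -> y \in e t -> G t y <> G s x.
  move=> st xe ye /(GD t None y _ ye _).2 H; apply: (QM _ (eQ _ _ ye)).
  by rewrite /= H; [exact: GM | rewrite mem_cat DG ?orbT].
exists (fun z => G (last 0 z) (take m z)).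
have hE' s x : increasing m x -> G (last 0 (rcons x s)) (take m (rcons x s)) = G s x.
  by move=> /andP[/eqP <- _]; rewrite last_rcons -cats1 take_size_cat.
split.
- move=> z /increasingS[x [t [-> xm xt]]].
  by rewrite hE' //; apply: GP; rewrite eP xm.
- move=> z z' /increasingS[x [s [-> xm xs]]] /increasingS[y [t [-> ym yt]]].
  rewrite !hE' //.
  have xe : x \in e s by rewrite eP xm.
  have ye : y \in e t by rewrite eP ym.
  case: (ltngtP s t) => [st /esym /Gneq []//|ts /Gneq []//|st] xy.
  rewrite st in xe xs xy *; congr rcons; apply: hinj => //.
  exact: (GG t None x y xe ye).2.
- move=> i z z' /increasingS[x [s [-> xm xs]]] /increasingS[y [t [-> ym yt]]].
  rewrite !hE' //.
  have xe : x \in e s by rewrite eP xm.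
  have ye : y \in e t by rewrite eP ym.
  have [/eqP szx /eqP szy] : size x == m /\ size y == m.
    by move: xm ym => /andP[-> _] /andP[-> _].
  have nthx k : k < m -> nth 0 (rcons x s) k = nth 0 x k.
    by move=> km; rewrite nth_rcons szx km.
  have nthy k : k < m -> nth 0 (rcons y t) k = nth 0 y k.
    by move=> km; rewrite nth_rcons szy km.
  have [iJ|iJ] := boolP (i \in J).
    rewrite GJE // hE //; split=> H k km.
      move: km; rewrite ltnS leq_eqVlt => /orP[/eqP ->|km]; first by rewrite ltnn.
      by rewrite km nthx // nthy //; exact: H.
    by rewrite -nthx // -nthy // => kS; apply: H; rewrite ?km // ltnW.
  have RHS_st : (forall k, k < m.+1 -> ~~ (if k < m then S i k else false) ->
      nth 0 (rcons x s) k = nth 0 (rcons y t) k) -> s = t.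
    move=> /(_ m (leqnn _)); rewrite ltnn => /(_ isT).
    by rewrite !nth_rcons szx szy ltnn eqxx.
  case: (ltngtP s t) => st.
  + split=> [/E_sym /(GN _ _ _ _ _ st xe ye iJ) //|/RHS_st sE].
    by rewrite sE ltnn in st.
  + split=> [/(GN _ _ _ _ _ st ye xe iJ) //|/RHS_st sE].
    by rewrite sE ltnn in st.
  rewrite st in xe xs nthx *.
  rewrite -[E i _ _]/(structure_rel P (Some (Some i)) _ _) -GG //= hE //.
  split=> H k km.
    move: km; rewrite ltnS leq_eqVlt => /orP[/eqP ->|km].
      by rewrite !nth_rcons szx szy ltnn eqxx.
    by rewrite km nthx // nthy //; exact: H.
  by rewrite -nthx // -nthy // => kS; apply: H; rewrite ?km // ltnW.
Qed.

Lemma halfcube_pad (P : set A) m S h : halfcube_in P m.+1 S h ->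
  exists h', halfcube_in P m.+2 (fun i k => S i (minn k m)) h'.
Proof.
move=> [hP hinj hE].
(* The last two coordinates [a < b] are merged into [b * b + a >= a]. *)
pose c z := rcons (take m z) (nth 0 z m.+1 * nth 0 z m.+1 + nth 0 z m).
have cE z : increasing m.+2 z -> exists x a b,
    [/\ z = rcons (rcons x a) b, size x = m, a < b, c z = rcons x (b * b + a)
      & increasing m.+1 (c z)].
  move=> /increasingS[_ [b [-> /increasingS[x [a [-> xm xa]]]]]].
  rewrite all_rcons => /andP[ab _]; have /eqP szx : size x == m by case/andP: xm.
  have cx : c (rcons (rcons x a) b) = rcons x (b * b + a).
    by rewrite /c !nth_rcons !size_rcons szx !ltnn ltnSn !eqxx -!cats1 -catA take_size_cat.
  exists x, a, b; split=> //; rewrite cx increasing_rcons xm /=.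
  by apply: sub_all xa => k /= ka; apply: leq_trans ka (leq_addl _ _).
exists (h \o c); split=> [z /cE[x [a [b [_ _ _ _ /hP]]]] //| |].
- move=> z z' /cE[x [a [b [-> _ ab cz zm]]]] /cE[x' [a' [b' [-> _ ab' cz' zm']]]].
  move=> /= /(hinj _ _ zm zm'); rewrite cz cz' => /rcons_inj[-> /square_code_inj].
  by case=> // -> ->.
- move=> i z z' /cE[x [a [b [zE szx ab cz zm]]]] /cE[x' [a' [b' [zE' szx' ab' cz' zm']]]].
  rewrite /= hE // cz cz' zE zE'; split=> H k km.
    move: km; rewrite !ltnS leq_eqVlt => /orP[/eqP ->|].
      rewrite (minn_idPr (leqnSn _)) => Sm; have := H m (leqnn _) Sm.
      rewrite !nth_rcons !size_rcons szx szx' ltnn !eqxx ltnn /=.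
      by case/square_code_inj.
    rewrite ltnS => km; rewrite (minn_idPl km) => Sk; have := H k km Sk.
    rewrite !nth_rcons !size_rcons szx szx'; move: km; rewrite leq_eqVlt.
    case/orP => [/eqP -> | km]; last by rewrite ltnS (ltnW km) km.
    by rewrite ltnn eqxx ltnSn; case/square_code_inj.
  move=> Sk; rewrite !nth_rcons szx szx'; move: (km).
  rewrite ltnS leq_eqVlt => /orP[/eqP kE|km'].
    have := H m.+1 (leqnn _); rewrite (minn_idPr (leqnSn _)) -{1}kE => /(_ Sk).
    have := H m (ltnW (leqnn _)); rewrite minnn -{1}kE => /(_ Sk).
    by rewrite !nth_rcons !size_rcons szx szx' !ltnn ltnSn kE !eqxx ltnn => -> ->.
  have := H k (ltnW km); rewrite (minn_idPl (ltnW km')) => /(_ Sk).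
  by rewrite !nth_rcons !size_rcons szx szx' km' km.
Qed.

(** The induction below only bounds the dimension, while the theorem needs it to be exactly [n].
    Padding splits an existing coordinate, hence [0 < m]. *)
Lemma halfcube_pad_to (P : set A) m N S h : 0 < m -> m <= N -> halfcube_in P m S h ->
  exists S' h', halfcube_in P N S' h' /\
    forall i, (exists2 k, k < m & S i k) -> exists2 k, k < N & S' i k.
Proof.
move=> m0 /subnKC <- hc; elim: (N - m) => [|d [S' [h' [hc' hS']]]].
  by rewrite addn0; exists S, h.
case: m m0 {hc} hc' hS' => // m _ /halfcube_pad[h'' hc''] hS'.
exists (fun i k => S' i (minn k (m + d))), h''; rewrite addSn addnS; split=> // i /hS'[k km Sk].
exists k; first by rewrite ltnS ltnW // -addSn.
by rewrite (minn_idPl _) // -ltnS -addSn.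
Qed.

(** * Halfcubes of dimension zero and one *)

Lemma point_halfcube (P : set A) x :
  P x -> halfcube_in P 0 (fun _ _ => false) (fun=> x).
Proof.
move=> Px; split=> [//|y z /andP[/nilP -> _] /andP[/nilP -> _]|i y z _ _]; first by [].
by split=> // _; exact: E_refl.
Qed.

(** One relation at a time: if some class has infinitely many points of the current set, keep those;
    otherwise infinitely many classes are met, and one point is kept from each. *)
Lemma infinite_homogeneous (s : seq 'I_n) (Q : set A) : infinite_set Q ->
  exists Q' : set A, [/\ Q' `<=` Q, infinite_set Q' & forall i, i \in s ->
    (forall x y, Q' x -> Q' y -> E i x y) \/
    (forall x y, Q' x -> Q' y -> E i x y -> x = y)].
Proof.
move=> Qinf; elim: s => [|i s [Q' [Q'Q Q'inf Q's]]]; first by exists Q; split.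
suff [R [RQ' Rinf Ri]] : exists R : set A, [/\ R `<=` Q', infinite_set R &
    (forall x y, R x -> R y -> E i x y) \/ (forall x y, R x -> R y -> E i x y -> x = y)].
  exists R; split=> // [x /RQ'/Q'Q //|j]; rewrite inE => /orP[/eqP -> //|/Q's[]H].
    by left=> x y /RQ' Rx /RQ'; exact: H.
  by right=> x y /RQ' Rx /RQ'; exact: H.
have [[a ainf]|afin] := pselect (exists a, infinite_set (Q' `&` [set x | E i a x])).
  exists (Q' `&` [set x | E i a x]); split=> [x []||] //.
  by left=> x y [_ /= ax] [_ /= ay]; apply: E_trans ay; exact: E_sym.
have /choice[rep repP] : forall X : set A, exists y, X !=set0 -> X y.
  move=> X; have [[y Xy]|nX] := pselect (X !=set0); first by exists y.
  have [y _] := infinite_setN0 Q'inf.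
  by exists y.
pose C x := Q' `&` [set y | E i x y].
have CE x y : E i x y -> C x = C y.
  move=> xy; apply/seteqP; split=> z [Qz /= H]; split=> //=; last exact: E_trans H.
  by apply: E_trans H; exact: E_sym.
have repC x : Q' x -> C x (rep (C x)) by move=> Qx; apply: repP; exists x; split=> //=.
exists (Q' `&` [set x | rep (C x) = x]); split; first by move=> x [].
  move=> Rfin; apply: Q'inf.
  apply: (@sub_finite_set _ _ (\bigcup_(x in Q' `&` [set x | rep (C x) = x]) C x)).
    move=> x Q'x; have [Qr xr] := repC x Q'x; exists (rep (C x)); last first.
      by split=> //; exact: E_sym.
    by split=> //=; rewrite -(CE _ _ xr).
  apply: bigcup_finite => // x _; apply: contra_notP afin => H; exists x; exact: H.
by right=> x y [_ /= xr] [_ /= yr] /CE xy; rewrite -xr xy.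
Qed.

(** On an infinite homogeneous subset each [E i] is total or equality, which decides whether the
    only coordinate is in [S i]. For [i] in [I] it is total, as all points are in the class of
    [c i]. *)
Lemma line_halfcube (P : set A) (I : {set 'I_n}) (c : 'I_n -> A) :
  infinite_set [set x | P x /\ forall i, i \in I -> E i (c i) x] ->
  exists S h, halfcube_in P 1 S h /\ forall i, i \in I -> S i 0.
Proof.
move=> /(infinite_homogeneous (enum 'I_n))[Q [QP Qinf QE]].
have [u uinj uQ] := infinite_set_seq Qinf.
have inc1 x : increasing 1 x -> x = [:: nth 0 x 0] by case: x => [|a []].
exists (fun i _ => `[< forall x y, Q x -> Q y -> E i x y >]), (fun x => u (nth 0 x 0)).
split; first split.
- by move=> x _; have [] := QP _ (uQ (nth 0 x 0)).
- by move=> x y /inc1 xE /inc1 yE /uinj xy; rewrite xE yE xy.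
- move=> i x y _ _; have [H|H] := QE i (mem_enum _ i).
    split=> [_ k _|_]; last exact: H.
    by move=> /asboolP; case.
  split=> [/(H _ _ (uQ _) (uQ _))/uinj xy [|//] _ _ //|].
  move=> /(_ 0 isT) xy; rewrite xy; first exact: E_refl.
  apply/asboolP => H'; have /uinj // : u 0 = u 1.
  by apply: H => //; exact: H'.
- move=> i iI; apply/asboolP => x y /QP[_ /(_ i iI) cx] /QP[_ /(_ i iI)].
  by apply: E_trans; exact: E_sym.
Qed.

(** * Colourings with a restricted set of colours *)

Variable i0 : 'I_n.

Definition colorable (I : {set 'I_n}) (Q : set A) : Prop :=
  exists2 chi : A -> 'I_n, forall x, Q x -> chi x \in I &
    forall a i, finite_set [set x | [/\ Q x, E i a x & chi x = i]].

Lemma colorable_sub (I : {set 'I_n}) (Q R : set A) :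
  Q `<=` R -> colorable I R -> colorable I Q.
Proof.
move=> QR [chi chiI chifin]; exists chi => [x /QR/chiI //|a i].
by apply: sub_finite_set (chifin a i) => x [/QR].
Qed.

(** If [x] in the [E i]-class of [a] has colour [i], then all its classes with index in [I] have
    appeared by the time this class does. So [x] lies in one of finitely many intersections of
    classes, each finite by assumption. *)
Lemma countable_colorable (I : {set 'I_n}) (Q : set A) :
  I != set0 -> countable Q ->
  (forall c : 'I_n -> A, finite_set [set x | Q x /\ forall i, i \in I -> E i (c i) x]) ->
  colorable I Q.
Proof.
move=> /set0Pn[i1 i1I] /countable_injP[f finj] Qfin.
(* [F (i, x)] is the position at which the [E i]-class of [x] first appears. *)
have /choice[F FP] : forall p : 'I_n * A, exists k, Q p.2 ->
    (exists y, [/\ Q y, f y = k & E p.1 p.2 y]) /\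
    (forall y, Q y -> E p.1 p.2 y -> k <= f y).
  move=> [i x] /=; have [Qx|nQx] := pselect (Q x); last by exists 0.
  pose T := [pred k | `[< exists y, [/\ Q y, f y = k & E i x y] >]].
  have exT : exists k, T k by exists (f x); apply/asboolP; exists x.
  case: (ex_minnP exT) => k /asboolP Tk kmin; exists k => _; split=> // y Qy xy.
  by apply: kmin; apply/asboolP; exists y.
(* Colour [x] by the index of the class that appears last in the enumeration. *)
pose chi x := [arg max_(i > i1 in I) F (i, x)].
exists chi => [x _|a i]; first by rewrite /chi; case: arg_maxnP.
have [|nfin] := pselect (finite_set [set x | [/\ Q x, E i a x & chi x = i]]); first by [].
have [x1 [Qx1 ax1 _]] := infinite_setN0 nfin; case: nfin.
have FE x y : Q x -> Q y -> E i x y -> F (i, x) <= F (i, y).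
  move=> Qx Qy xy; have [_ H] := FP (i, x) Qx; have [[z [Qz <- yz]] _] := FP (i, y) Qy.
  by apply: H => //=; exact: E_trans yz.
pose N := F (i, x1).
have [g gP] : exists g : nat -> A, forall x, Q x -> g (f x) = x.
  have /choice[g gP] : forall k, exists y, forall x, Q x -> f x = k -> y = x.
    move=> k; have [[y Qy yk]|nk] := pselect (exists2 y, Q y & f y = k).
      by exists y => x Qx xk; apply: finj; rewrite ?yk //; exact: mem_set.
    by exists x1 => x Qx xk; case: nk; exists x.
  by exists g => x Qx; exact: gP.
apply: (@sub_finite_set _ _ (\bigcup_(t in [set: {ffun 'I_n -> 'I_N.+1}])
  [set x | Q x /\ forall j, j \in I -> E j (g (t j)) x])); last first.
  by apply: bigcup_finite => [|t _]; [exact: finite_finset | exact: (Qfin (fun j => g (t j)))].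
move=> x [Qx ax chix].
have FN j : j \in I -> F (j, x) <= N.
  move=> jI; apply: (@leq_trans (F (i, x))).
    by rewrite -chix /chi; case: arg_maxnP => // k _; exact.
  by apply: FE => //; apply: E_trans ax1; exact: E_sym.
exists [ffun j => inord (F (j, x))] => //; split=> // j jI.
rewrite ffunE inordK ?ltnS ?FN //.
have [[y [Qy <- xy]] _] := FP (j, x) Qx.
by rewrite gP //; exact: E_sym.
Qed.

(** * Layers of a well-ordered chain *)

Variable le : rel A.
Hypothesis le_wo : well_order le.

(** A well-order is given through unique least elements; the order axioms below follow from sets of
    at most three elements. *)
Let least (X : set A) : X !=set0 -> exists2 z, X z & forall x, X x -> le z x.
Proof.
move=> [x Xx]; have [|z [[Xz zmin] _]] := @le_wo [pred x | `[< X x >]].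
  by exists x; apply/asboolP.
exists z; first exact/asboolP.
by move=> y Xy; apply: zmin; apply/asboolP.
Qed.

Let le_anti x y : le x y -> le y x -> x = y.
Proof.
have [|z [_ zuniq]] := @le_wo [pred z | (z == x) || (z == y)]; first by exists x; rewrite inE eqxx.
have le_refl u : le u u.
  by have [v -> H] := @least [set u] (ex_intro _ u erefl); exact: H.
move=> xy yx; have xE : z = x.
  by apply: zuniq; split=> [|u]; rewrite inE ?eqxx // => /orP[] /eqP ->.
rewrite -xE; apply: zuniq; split=> [|u]; rewrite inE ?eqxx ?orbT //.
by move=> /orP[] /eqP ->.
Qed.

Let le_total x y : le x y \/ le y x.
Proof.
have [|z [->|->] H] := @least [set z | z = x \/ z = y]; first by exists x; left.
  by left; apply: H; right.
by right; apply: H; left.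
Qed.

Let le_refl x : le x x. Proof. by case: (le_total x x). Qed.

Let le_trans y x z : le x y -> le y z -> le x z.
Proof.
move=> xy yz.
have [|u [->|[->|->]] H] := @least [set u | u = x \/ u = y \/ u = z].
- by exists x; left.
- by apply: H; right; right.
- by have <- : y = x by apply: le_anti => //; apply: H; left.
- have zy : z = y by apply: le_anti => //; apply: H; right; left.
  by rewrite zy.
Qed.

(** As [le] is total, [~~ le b c] says that [c] strictly precedes [b]. *)
Definition below (W : set A) (M : A -> set A) (b : A) : set A :=
  \bigcup_(c in [set c | W c /\ ~~ le b c]) M c.

Definition layer (P W : set A) (M : A -> set A) (b : A) (J : {set 'I_n}) : set A :=
  [set x | [/\ P x, M b x, ~ below W M b x &
    forall i, i \in J <-> exists2 y, below W M b y & E i x y]].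

Lemma colorable_layers (I : {set 'I_n}) (P W : set A) (M : A -> set A) :
  (forall b J, W b -> colorable (I :\: J) (layer P W M b J)) ->
  colorable I (P `&` \bigcup_(b in W) M b).
Proof.
move=> Lcol; set U := \bigcup_(b in W) M b.
(* [beta x] is the first stage that contains [x]. *)
have /choice[beta betaP] : forall x, exists b, U x ->
    [/\ W b, M b x & ~ below W M b x].
  move=> x; have [[b0 Wb0 Mb0x]|nU] := pselect (U x); last by exists x.
  have [|b [Wb Mbx] bmin] := @least [set b | W b /\ M b x]; first by exists b0.
  exists b => _; split=> // -[c [Wc bc] Mcx].
  by rewrite bmin in bc.
pose J x : {set 'I_n} := finset (fun i => `[< exists2 y, below W M (beta x) y & E i x y >]).
have layerP x : P x -> U x -> layer P W M (beta x) (J x) x.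
  move=> Px Ux; have [Wb Mb nb] := betaP x Ux; split=> // i.
  by rewrite inE; split=> [/asboolP|H]; [|apply/asboolP].
have /choice[chi chiP] : forall p : A * {set 'I_n}, exists chi : A -> 'I_n, W p.1 ->
    (forall x, layer P W M p.1 p.2 x -> chi x \in I :\: p.2) /\
    (forall a i, finite_set [set x | [/\ layer P W M p.1 p.2 x, E i a x & chi x = i]]).
  move=> [b K] /=; have [Wb|nWb] := pselect (W b); last by exists (fun=> i0).
  by have [chi ? ?] := Lcol b K Wb; exists chi.
exists (fun x => chi (beta x, J x) x) => [x [Px Ux]|a i].
  have [Wb _ _] := betaP x Ux; have [/(_ _ (layerP x Px Ux)) + _] := chiP (beta x, J x) Wb.
  by rewrite inE => /andP[].
have [[y0 Uy0 ay0]|noy] := pselect (exists2 y, U y & E i a y); last first.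
  apply: (@sub_finite_set _ _ classical_sets.set0); last exact: finite_set0.
  by move=> x [[_ Ux] ax _]; apply: noy; exists x.
have [|b [y [Uy ay yb]] bmin] := @least [set b | exists y, [/\ U y, E i a y & beta y = b]].
  by exists (beta y0), y0.
have [Wb Mby _] := betaP y Uy; rewrite yb in Wb Mby.
apply: (@sub_finite_set _ _ (\bigcup_(K in [set: {set 'I_n}])
    [set x | [/\ layer P W M b K x, E i a x & chi (b, K) x = i]])); last first.
  apply: bigcup_finite => [|K _]; first exact: finite_finset.
  by have [_] := chiP (b, K) Wb; exact.
move=> x [[Px Ux] ax chix]; have [Wx Mx nbx] := betaP x Ux.
have [xb|/negP xb] := boolP (le (beta x) b).
  have {}xb : beta x = b by apply: le_anti => //; apply: bmin; exists x.
  by exists (J x) => //; rewrite -xb; split=> //; exact: layerP.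
(* At a stage after [b], the point [y] lies below and puts [i] into [J x], so [x] cannot have colour
   [i]. *)
have [/(_ _ (layerP x Px Ux)) + _] := chiP (beta x, J x) Wx.
rewrite chix !inE => /andP[/asboolP []]; exists y; last first.
  by apply: E_trans ay; exact: E_sym.
by exists b => //; split=> //; exact/negP.
Qed.

Lemma uncolorable_halfcube (I : {set 'I_n}) (P : set A) : ~ colorable I P ->
  exists m S h, [/\ m <= #|I|, halfcube_in P m S h &
    forall i, i \in I -> exists2 k, k < m & S i k].
Proof.
move: {2}#|I|.+1 (ltnSn #|I|) => N; elim: N I P => // N IH I P IN.
apply: contra_notP => no_halfcube.
(* Without colours only the empty set is colourable, and a single point is a halfcube of dimension
   0. *)
have [I0|I0] := eqVneq I set0.
  exists (fun=> i0) => [x Px|a i].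
    case: no_halfcube; exists 0, (fun _ _ => false), (fun=> x); split=> //.
      exact: point_halfcube.
    by move=> i; rewrite I0 inE.
  apply: (@sub_finite_set _ _ classical_sets.set0); last exact: finite_set0.
  move=> x [Px _ _]; apply: no_halfcube.
  exists 0, (fun _ _ => false), (fun=> x); split=> //; first exact: point_halfcube.
  by move=> j; rewrite I0 inE.
have Pfin c : finite_set [set x | P x /\ forall i, i \in I -> E i (c i) x].
  apply: contrapT => /(line_halfcube)[S [h [hc hS]]]; apply: no_halfcube.
  by exists 1, S, h; split=> [|//|i /hS Si]; [rewrite card_gt0 | exists 0].
pose r := structure_rel P.
(* A layer whose [J] misses [I] is part of the colourable [M b]. Otherwise [I :\: J] is smaller, and
   a halfcube from the induction hypothesis gains a coordinate that serves the indices in [J]. *)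
have union W (M : A -> set A) :
    (forall b c, W b -> W c -> le b c -> M b `<=` M c) ->
    (forall b, W b -> skolem_closed r (M b)) ->
    (forall b, W b -> colorable I (P `&` M b)) ->
    colorable I (P `&` \bigcup_(b in W) M b).
  move=> Mmono Mcl Mcol; apply: colorable_layers => b J Wb.
  have [->|IJ] := eqVneq (I :\: J) I.
    by apply: colorable_sub (Mcol b Wb) => x [].
  apply: contrapT => ncol.
  have ltIJ : #|I :\: J| < #|I|.
    by apply: proper_card; rewrite properEneq IJ subsetDl.
  have [m [S [h [mI hc hS]]]] := IH _ _ (leq_trans ltIJ IN) ncol.
  have [j jI jJ] : exists2 j, j \in I & j \in J.
    apply: contrapT => nj; case/negP: IJ; apply/eqP/setP => i.
    rewrite inE; case iI: (i \in I); rewrite ?andbF // andbT.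
    by apply/negP => iJ; apply: nj; exists i.
  have below0 : below W M b !=set0.
    have [hL _ _] := hc; have [|_ _ _ /(_ j)[/(_ jJ)[y by_ _] _]] := hL (iota 0 m).
      by rewrite /increasing size_iota eqxx iota_ltn_sorted.
    by exists y.
  have below_cl : skolem_closed r (below W M b).
    apply: skolem_closed_bigcup => [c d [Wc _] [Wd _]|c [Wc _]]; last exact: Mcl.
    by have [cd|dc] := le_total c d; [left|right]; exact: Mmono.
  have [| | |h' hc'] := halfcube_extend below_cl below0 _ _ _ hc (J := J).
  - by move=> x [].
  - by move=> x [].
  - by move=> x i [_ _ _]; exact.
  apply: no_halfcube; exists m.+1, (fun i k => if k < m then S i k else i \in J), h'.
  split=> [|//|i iI]; first exact: leq_ltn_trans mI ltIJ.
  have [iJ|iJ] := boolP (i \in J); first by exists m; rewrite // ltnn.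
  by have [|k km Sk] := hS i; [rewrite inE iJ | exists k; rewrite ?km // ltnW].
pose seg (g : A -> A) b := skolem_hull r (g @` [set c | le c b]).
have seg_mono g b c : le b c -> seg g b `<=` seg g c.
  move=> bc; apply: skolem_hull_mono => _ [x /= xb <-].
  by exists x => //=; exact: le_trans bc.
have seg_cl g b : skolem_closed r (seg g b) by exact: skolem_hull_closed.
have segs_cl g W : skolem_closed r (\bigcup_(b in W) seg g b).
  apply: skolem_closed_bigcup => [b c _ _|b _]; last exact: seg_cl.
  by have [bc|cb] := le_total b c; [left|right]; exact: seg_mono.
(* The family [g] is arbitrary so that minimality of [b] also applies to reindexed generators. *)
have seg_col b : forall g, colorable I (P `&` seg g b).
  apply: contrapT => nb0.
  have [|{nb0}b nb bmin] := @least [set b | ~ forall g, colorable I (P `&` seg g b)].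
    by exists b.
  apply: nb => g.
  have IHb c : ~~ le b c -> forall g, colorable I (P `&` seg g c).
    by move=> bc; apply: contrapT => /bmin; exact/negP.
  have [fin|inf] := pselect (finite_set [set c | ~~ le b c]).
    apply: countable_colorable => // [|c]; last first.
      by apply: sub_finite_set (Pfin c) => x [[Px _] cx].
    apply: (@sub_countable _ _ _ (seg g b)); first exact: subset_card_le (@subIsetr _ _ _).
    apply: countable_skolem_hull; apply: finite_set_countable; apply: finite_image.
    apply: (@sub_finite_set _ _ ([set c | ~~ le b c] `|` [set b])).
      move=> c /= cb; have [bc|bc] := boolP (le b c); last by left.
      by right; exact: le_anti.
    by rewrite finite_setU; split=> //; exact: finite_set1.
  (* The proper initial segment below [b] is infinite, hence surjects onto the
     segment up to [b], and can be used instead to index the generators. *)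
  have [u uinj ub] := infinite_set_seq inf.
  have [f fP] : exists f : A -> A, forall c, le c b -> exists2 d, ~~ le b d & f d = c.
    (* A shift along [u] makes room for [b]; points off the sequence stay fixed. *)
    have /choice[f fP] : forall d, exists c, (d = u 0 -> c = b) /\
        (forall k, d = u k.+1 -> c = u k) /\ ((forall k, d <> u k) -> c = d).
      move=> d; have [[[|k] ->]|nd] := pselect (exists k, d = u k).
      - exists b; split=> //; split=> [k /uinj //|/(_ 0) //].
      - exists (u k); split=> [/uinj //|]; split=> [l /uinj[->] //|/(_ k.+1) //].
      - exists d; split=> [d0|]; first by case: nd; exists 0.
        by split=> // k dk; case: nd; exists k.+1.
    exists f => c cb; have [[k ck]|nc] := pselect (exists k, c = u k).
      exists (u k.+1); first exact: ub.
      by rewrite ck; have [_ [+ _]] := fP (u k.+1); apply.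
    have [bc|bc] := boolP (le b c).
      exists (u 0); first exact: ub.
      by rewrite (le_anti cb bc); have [+ _] := fP (u 0); apply.
    by exists c => //; have [_ [_ +]] := fP c; apply=> k ck; apply: nc; exists k.
  have := union [set c | ~~ le b c] (seg (g \o f)).
  move=> /(_ (fun b c _ _ => @seg_mono _ b c) (fun b _ => @seg_cl _ b)).
  move=> /(_ (fun c bc => IHb c bc _)); apply: colorable_sub => x [Px gx].
  split=> //; apply: skolem_hull_min gx => // _ [c /= cb <-].
  have [d bd fd] := fP c cb; exists d => //; apply: skolem_hull_gen.
  by exists d => //=; rewrite fd.
have := union [set: A] (seg id).
move=> /(_ (fun b c _ _ => @seg_mono _ b c) (fun b _ => @seg_cl _ b)).
move=> /(_ (fun c _ => seg_col c _)); apply: colorable_sub => x Px.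
by split=> //; exists x => //; apply: skolem_hull_gen; exists x => //=.
Qed.

End Halfcubes.

(** * Back to hyperspaces and weak embeddings *)

Lemma eqclass_eq (n : nat) (B : hyperspace n) (i : 'I_n) (x y : B) :
  eqclass i x = eqclass i y <-> hrel i x y.
Proof.
have [r s t] := hrel_equiv B i; split=> [xy|xy].
  have : eqclass i y y by exact: r.
  by rewrite -xy.
apply/seteqP; split=> z /= H; first by apply: t H; exact: s.
exact: t H.
Qed.

Theorem theorem4p2 (n : nat) (n_ge1 : 1 <= n) (A : hyperspace n)
    (no_halfcube : forall S : 'I_n -> {set 'I_n},
      (forall i : 'I_n, S i != set0) -> ~ weakly_embeddable (halfcube S) A) :
  exists chi : A -> 'I_n, acceptable chi.
Proof.
pose E i (x y : {classic A}) := hrel i x y.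
have E_equiv i : Equivalence (E i) := hrel_equiv A i.
have [le le_wo] := well_ordering_principle {classic A}.
apply: contrapT => no_chi.
have ncol : ~ colorable E [set: 'I_n]%SET [set: A].
  move=> [chi _ chi_fin]; apply: no_chi; exists chi => a i.
  by apply: sub_finite_set (chi_fin a i) => x [].
have [m [S [h [mn hc hS]]]] := uncolorable_halfcube E_equiv (Ordinal n_ge1) le_wo ncol.
(* As [n] is positive there is a colour; its coordinate [k] shows [0 < m], as padding requires. *)
have [k km _] := hS (Ordinal n_ge1) (in_setT _).
rewrite cardsT card_ord in mn.
have [S' [h' [[_ hinj hE] S'0]]] :=
  halfcube_pad_to (leq_ltn_trans (leq0n k) km) mn hc.
pose T i : {set 'I_n} := finset (fun k : 'I_n => S' i k).
apply: (no_halfcube T) => [i|].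
  have [l ln S'l] := S'0 i (hS i (in_setT _)).
  by apply/set0Pn; exists (Ordinal ln); rewrite inE.
have incr (x : halfcube T) : increasing n (sval x).
  by case: x => x /= xs; rewrite /increasing size_tuple eqxx.
exists (fun x : halfcube T => h' (sval x)); split=> [x y /hinj xy|].
  by apply/val_inj/val_inj; exact: xy.
exists 1%g => x y i; rewrite perm1 !eqclass_eq; split=> H.
  apply/hE => // l ln S'l; have := H (Ordinal ln).
  by rewrite inE /= !(tnth_nth 0) => /(_ S'l).
move=> j; rewrite inE => S'j; rewrite !(tnth_nth 0).
by have /hE := H; apply.
Qed.
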